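(* For any $r>0$ there exists $C_r>0$ depending only on $r$ such that for all complex-valued $w,\tilde w\in L_2(0,\pi)$ with $\|w\|_{L_2(0,\pi)}\le r$ and $\|\tilde w\|_{L_2(0,\pi)}\le r$ one has $$\|N-\tilde N\|_{\infty,\pi}\le C_r\,\|w-\tilde w\|_{L_\infty(0,\pi)},$$ where $N\in L_{2,\pi}$ and $\tilde N\in L_{2,\pi}$ are the solutions of the nonlinear integral equations $$w(\pi-x)=\sum_{\nu=1}^\infty\frac{(\pi-x)^\nu}{\nu!}N^{*\nu}(x),\qquad \tilde w(\pi-x)=\sum_{\nu=1}^\infty\frac{(\pi-x)^\nu}{\nu!}\tilde N^{*\nu}(x),\qquad 0<x<\pi,$$ respectively.
   Context: $L_{2,\pi}:=\{f:(\pi-x)f(x)\in L_2(0,\pi)\}$ (complex-valued functions), $\|f\|_{\infty,\pi}:=\|(\pi-x)f(x)\|_{L_\infty(0,\pi)}$. Convolution: $f*g(x)=\int_0^x f(x-t)g(t)\,dt$, $f^{*1}=f$, $f^{*(\nu+1)}=f*f^{*\nu}$ for $\nu\ge1$. It is known that for every $w\in L_2(0,\pi)$ the equation $w(\pi-x)=\sum_{\nu\ge1}\frac{(\pi-x)^\nu}{\nu!}N^{*\nu}(x)$ (equality a.e. on $(0,\pi)$) has a unique solution $N\in L_{2,\pi}$. The right-hand side of the estimate may be $+\infty$; an inequality with a possibly infinite right-hand side means that if the right-hand side is finite, then so is the left-hand side and the inequality holds. *)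

(* Defs.v *)
From HB Require Import structures.
From mathcomp Require Import all_boot all_order all_algebra.
From mathcomp Require Import all_classical all_reals all_analysis.
From mathcomp Require Import complex.

Set Implicit Arguments.
Unset Strict Implicit.
Unset Printing Implicit Defensive.

Import Order.TTheory GRing.Theory Num.Theory.
Import numFieldNormedType.Exports.

Local Open Scope classical_set_scope.
Local Open Scope ring_scope.
Local Open Scope complex_scope.

(* Functions on (0, pi) are total functions R -> R[i] whose values off ]0, pi[
   are never used: norms cut off to ]0, pi[, and conv f g x with x < pi only
   evaluates f and g on ]0, x[. *)

Definition Ipi {R : realType} : set R := `]0, pi[%classic.

Definition cmeasurable_fun {R : realType} (D : set R) (f : R -> R[i]) : Prop :=
  measurable_fun D (fun x => complex.Re (f x)) /\
  measurable_fun D (fun x => complex.Im (f x)).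

Definition cintegral {R : realType} (D : set R) (f : R -> R[i]) : R[i] :=
  Complex (\int[lebesgue_measure]_(x in D) complex.Re (f x))
          (\int[lebesgue_measure]_(x in D) complex.Im (f x)).

Definition cLnorm {R : realType} (p : \bar R) (f : R -> R[i]) : \bar R :=
  ('N[lebesgue_measure]_p[(fun x => (ComplexField.Normc.normc (f x))%:E) \_ Ipi])%E.

Definition in_L2 {R : realType} (f : R -> R[i]) : Prop :=
  cmeasurable_fun Ipi f /\ (cLnorm 2%:E f < +oo)%E.

Definition weight_pi {R : realType} (f : R -> R[i]) : R -> R[i] :=
  fun x => (pi - x)%:C * f x.

Definition in_L2pi {R : realType} (f : R -> R[i]) : Prop := in_L2 (weight_pi f).

Definition norm_inftypi {R : realType} (f : R -> R[i]) : \bar R :=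
  cLnorm +oo%E (weight_pi f).

Definition conv {R : realType} (f g : R -> R[i]) : R -> R[i] :=
  fun x => cintegral `]0, x[%classic (fun t => f (x - t) * g t).

(* The nu-th convolution power for nu >= 1; the value at nu = 0 is junk. *)
Definition convpow {R : realType} (f : R -> R[i]) (nu : nat) : R -> R[i] :=
  iter nu.-1 (conv f) f.

(* The series is understood pointwise, at almost every x; the codomain
   R[i]^o carries the topology of the modulus. *)
Definition is_solution {R : realType} (w N : R -> R[i]) : Prop :=
  {ae lebesgue_measure, forall x : R, Ipi x ->
    (\sum_(1 <= nu < n.+1)
        ((pi - x) ^+ nu / nu`!%:R)%:C * convpow N nu x : R[i]^o)
      @[n --> \oo] --> (w (pi - x) : R[i]^o)}.

(* Main.v *)
(* Weighting the nu-th convolution power by e^(-lam x) (pi - x)^nu makes the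
   weighted L1 norm on ]0, b[ submultiplicative: pi - x is at most pi - t and
   pi - (x - t), so the weight splits along the convolution, and the nu-th term of
   the series has norm at most s^nu, where s(b) is the norm of N weighted by
   e^(-lam x) (pi - x).
   A priori bound: for lam large in terms of r the norm of w(pi - x) is at most
   1/8. Now s is continuous in b, s(0) = 0, and the equation gives
   s <= 1/8 + sum_(nu >= 2) s^nu, so s never takes the value 1/4 and s(pi) <= 1/4.
   Stability: D = e^(-lam x) (pi - x) |N - N'| satisfies D <= eps + K * D with a
   kernel K of mass at most 1/3. With c = 2 eps and phi = max(D - c, 0) this gives
   phi <= K * phi, so the integral of phi is at most a third of itself; it is
   finite, hence D <= c almost everywhere. *)

Require Import Defs.
From HB Require Import structures.
From mathcomp Require Import all_boot all_order all_algebra.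
From mathcomp Require Import all_classical all_reals all_analysis.
From mathcomp Require Import complex.
From mathcomp Require Import measurable_realfun ess_sup_inf.
From mathcomp Require Import ring lra.

Set Implicit Arguments.
Unset Strict Implicit.
Unset Printing Implicit Defensive.

Import Order.TTheory GRing.Theory Num.Theory.
Import numFieldNormedType.Exports.

Local Open Scope classical_set_scope.
Local Open Scope ring_scope.

Local Notation J F := (\int[lebesgue_measure]_x F x)%E.
Local Notation normc := ComplexField.Normc.normc.

(** * Invariance of Lebesgue measure *)

Lemma measurable_fun_subr {R : realType} (a : R) (D : set R) :
  measurable_fun D (fun x => x - a).
Proof. by apply: measurable_funB => //; exact: measurable_cst. Qed.

Lemma measurable_fun_rsub {R : realType} (a : R) (D : set R) :
  measurable_fun D (fun x => a - x).
Proof. by apply: measurable_funB => //; exact: measurable_cst. Qed.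

(** Lebesgue measure is determined by its values on half-open intervals, and the preimage of such an
    interval under a translation is one of the same kind and length. *)
Lemma lebesgue_measure_subr {R : realType} (a : R) (A : set R) : measurable A ->
  pushforward (@lebesgue_measure R)
    ((fun x => x - a) : R -> measurableTypeR R) A =
  lebesgue_measure A.
Proof.
move=> mA; apply/esym/lebesgue_measure_unique => //= [|mf _ [[u v]] _ <-].
  exact: measurable_fun_subr.
rewrite /pushforward (_ : _ @^-1` _ = `]u + a, v + a]%classic).
  rewrite !lebesgue_measure_itv/= !lte_fin ltrD2r.
  by case: ifP => // _; rewrite -!EFinB; congr EFin; ring.
by apply/seteqP; split => x /=; rewrite !in_itv/= ltrBrDr lerBlDr.
Qed.

(** A reflection exchanges the open and the closed end of an interval, so the argument for
    translations does not carry over directly; the map is factored into a negation and a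
    translation. *)
Lemma lebesgue_measure_rsub {R : realType} (a : R) (A : set R) : measurable A ->
  pushforward (@lebesgue_measure R)
    ((fun x => a - x) : R -> measurableTypeR R) A =
  lebesgue_measure A.
Proof.
move=> mA; rewrite -[RHS]lebesgue_measureN//.
have mNA : measurable ((-%R : R -> measurableTypeR R) @^-1` A).
  by rewrite -[X in measurable X]setTI; exact: oppr_measurable.
rewrite [RHS]/pushforward -[RHS](lebesgue_measure_subr a)//.
by rewrite /pushforward; congr (lebesgue_measure _); apply/seteqP; split => x /=;
  rewrite opprB.
Qed.

Lemma ge0_integral_subr {R : realType} (a : R) (F : R -> \bar R) :
  measurable_fun setT F -> (forall x, 0 <= F x)%E ->
  (\int[lebesgue_measure]_x F (x - a)%R = \int[lebesgue_measure]_x F x)%E.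
Proof.
move=> mF F0.
transitivity (\int[pushforward (@lebesgue_measure R)
    ((fun x => x - a)%R : R -> measurableTypeR R)]_x F x)%E.
  by rewrite [RHS]ge0_integral_pushforward//; exact: measurable_fun_subr.
apply: eq_measure_integral => [|mf A mA _]; first exact: measurable_fun_subr.
exact: lebesgue_measure_subr.
Qed.

Lemma ge0_integral_rsub {R : realType} (a : R) (F : R -> \bar R) :
  measurable_fun setT F -> (forall x, 0 <= F x)%E ->
  (\int[lebesgue_measure]_x F (a - x)%R = \int[lebesgue_measure]_x F x)%E.
Proof.
move=> mF F0.
transitivity (\int[pushforward (@lebesgue_measure R)
    ((fun x => a - x)%R : R -> measurableTypeR R)]_x F x)%E.
  by rewrite [RHS]ge0_integral_pushforward//; exact: measurable_fun_rsub.
apply: eq_measure_integral => [|mf A mA _]; first exact: measurable_fun_rsub.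
exact: lebesgue_measure_rsub.
Qed.

Lemma ae_rsub {R : realType} (a : R) (P : R -> Prop) :
  {ae lebesgue_measure, forall x, P x} ->
  {ae lebesgue_measure, forall x, P (a - x)}.
Proof.
move=> [A [mA A0 PA]]; exists ((fun x => a - x) @^-1` A); split.
- by rewrite -[X in measurable X]setTI; exact: measurable_fun_rsub.
- by rewrite -A0 -[RHS](lebesgue_measure_rsub a).
- by move=> x /= Px; apply: PA.
Qed.

(* The library's hint for filters of almost everywhere sets does not recognise
   [lebesgue_measure] on the reals. *)
#[local] Instance lebesgue_ae_filter (R : realType) :
  Filter (nbhs (almost_everywhere (@lebesgue_measure R))).
Proof. exact: (ae_filter_ringOfSetsType (@lebesgue_measure R)). Qed.

(** * Convolution of nonnegative functions *)

(** The factors of interest vanish outside some []0, b[], which confines the integrand to []0, x[].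
    Values in [\bar R] allow estimates before any finiteness is known. *)
Definition pconv {R : realType} (F G : R -> \bar R) : R -> \bar R :=
  fun x => (\int[lebesgue_measure]_t (F (x - t)%R * G t))%E.

Lemma measurable_fun_conv_shift {d} {T : measurableType d} {R : realType}
    (f : R -> T) :
  measurable_fun setT f ->
  measurable_fun setT (fun z : R * R => f (z.1 - z.2)).
Proof.
move=> mf; apply: (measurableT_comp mf).
by apply: measurable_funB; [exact: measurable_fst|exact: measurable_snd].
Qed.

Lemma measurable_fun_pconv_integrand {R : realType} (F G : R -> \bar R) :
  measurable_fun setT F -> measurable_fun setT G ->
  measurable_fun setT (fun z : R * R => (F (z.1 - z.2)%R * G z.2)%E).
Proof.
move=> mF mG; apply: emeasurable_funM; first exact: measurable_fun_conv_shift.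
by apply: (measurableT_comp mG); exact: measurable_snd.
Qed.

Lemma measurable_pconv {R : realType} (F G : R -> \bar R) :
  measurable_fun setT F -> measurable_fun setT G ->
  (forall x, 0 <= F x)%E -> (forall x, 0 <= G x)%E ->
  measurable_fun setT (pconv F G).
Proof.
move=> mF mG F0 G0.
apply: (measurable_fun_fubini_tonelli_F (m2 := lebesgue_measure)
  (fun z : R * R => (F (z.1 - z.2)%R * G z.2)%E)).
  exact: measurable_fun_pconv_integrand.
by move=> z; rewrite mule_ge0.
Qed.

(** Tonelli's theorem and translation invariance. This identity is the source of the
    submultiplicativity of the weighted L1 norms. *)
Lemma integral_pconv {R : realType} (F G : R -> \bar R) :
  measurable_fun setT F -> measurable_fun setT G ->
  (forall x, 0 <= F x)%E -> (forall x, 0 <= G x)%E ->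
  (\int[lebesgue_measure]_x pconv F G x =
   \int[lebesgue_measure]_x F x * \int[lebesgue_measure]_x G x)%E.
Proof.
move=> mF mG F0 G0.
have mFG := measurable_fun_pconv_integrand mF mG.
have FG0 (z : R * R) : (0 <= F (z.1 - z.2)%R * G z.2)%E by rewrite mule_ge0.
have := fubini_tonelli (m1 := lebesgue_measure) (m2 := lebesgue_measure)
  (fun z : R * R => (F (z.1 - z.2)%R * G z.2)%E) mFG FG0.
rewrite /fubini_F /fubini_G/= => ->.
rewrite -ge0_integralZl//; last exact: integral_ge0.
apply: eq_integral => t _.
rewrite ge0_integralZr//; first by rewrite ge0_integral_subr.
by apply: (measurableT_comp mF); exact: measurable_fun_subr.
Qed.

Lemma pconv_ge0 {R : realType} (F G : R -> \bar R) :
  (forall x, 0 <= F x)%E -> (forall x, 0 <= G x)%E ->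
  forall x, (0 <= pconv F G x)%E.
Proof. by move=> F0 G0 x; apply: integral_ge0 => t _; rewrite mule_ge0. Qed.

Lemma measurable_pconv1 {R : realType} (F G : R -> \bar R) (x : R) :
  measurable_fun setT F -> measurable_fun setT G ->
  measurable_fun setT (fun t : R => F (x - t)%R * G t)%E.
Proof.
move=> mF mG; apply: emeasurable_funM => //.
by apply: (measurableT_comp mF); exact: measurable_fun_rsub.
Qed.

(** * Complex integrals *)

(* Unlike the modulus, this norm gives [nrm1 (\int f) <= \int (nrm1 \o f)]
   componentwise; it is still submultiplicative, so that the nu-th convolution
   power costs no factor depending on nu. *)
Definition nrm1 {R : rcfType} (z : R[i]) : R := `|complex.Re z| + `|complex.Im z|.

Lemma nrm1_ge0 {R : rcfType} (z : R[i]) : 0 <= nrm1 z.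
Proof. exact: addr_ge0. Qed.

Lemma nrm1D {R : rcfType} (x y : R[i]) : nrm1 (x + y) <= nrm1 x + nrm1 y.
Proof. by case: x => a b; case: y => c d; rewrite /nrm1/= addrACA lerD// ler_normD. Qed.

Lemma nrm1N {R : rcfType} (x : R[i]) : nrm1 (- x) = nrm1 x.
Proof. by case: x => a b; rewrite /nrm1/= !normrN. Qed.

Lemma nrm1M {R : rcfType} (x y : R[i]) : nrm1 (x * y) <= nrm1 x * nrm1 y.
Proof.
case: x => a b; case: y => c d; rewrite /nrm1/=.
have := ler_normB (a * c) (b * d); have := ler_normD (a * d) (b * c).
rewrite !normrM mulrDl !mulrDr; lra.
Qed.

Lemma nrm1_scale {R : rcfType} (c : R) (x : R[i]) : 0 <= c ->
  nrm1 ((c%:C)%C * x) = c * nrm1 x.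
Proof.
move=> c0; case: x => a b; rewrite /nrm1/= !mul0r subr0 addr0.
by rewrite !normrM ger0_norm// mulrDr.
Qed.

Lemma normc_le_nrm1 {R : rcfType} (x : R[i]) :
  normc x <= nrm1 x.
Proof.
case: x => a b; rewrite /nrm1/=.
rewrite -[leRHS]ger0_norm ?addr_ge0// -[leRHS]sqrtr_sqr ler_wsqrtr//.
rewrite sqrrD !real_normK ?num_real//.
have : 0 <= `|a| * `|b| by rewrite mulr_ge0.
lra.
Qed.

Lemma ler_norm_Re_normc {R : rcfType} (x : R[i]) :
  `|complex.Re x| <= normc x.
Proof. by case: x => a b /=; rewrite -sqrtr_sqr ler_wsqrtr// lerDl sqr_ge0. Qed.

Lemma ler_norm_Im_normc {R : rcfType} (x : R[i]) :
  `|complex.Im x| <= normc x.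
Proof. by case: x => a b /=; rewrite -sqrtr_sqr ler_wsqrtr// lerDr sqr_ge0. Qed.

Lemma nrm1_le_normc {R : rcfType} (x : R[i]) :
  nrm1 x <= 2 * normc x.
Proof.
by rewrite mulr2n mulrDl !mul1r lerD ?ler_norm_Re_normc ?ler_norm_Im_normc.
Qed.

Lemma cmeasurable_funS {R : realType} (D E : set R) (f : R -> R[i]) :
  measurable D -> E `<=` D -> cmeasurable_fun D f -> cmeasurable_fun E f.
Proof.
by move=> mD ED [mr mi]; split; [exact: measurable_funS mr|
  exact: measurable_funS mi].
Qed.

Lemma cmeasurable_funM {R : realType} (D : set R) (f g : R -> R[i]) :
  cmeasurable_fun D f -> cmeasurable_fun D g ->
  cmeasurable_fun D (fun x => f x * g x).
Proof.
move=> [fr fi] [gr gi]; split.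
- rewrite (_ : (fun _ => _) = (fun x => complex.Re (f x) * complex.Re (g x)) \-
     (fun x => complex.Im (f x) * complex.Im (g x))); last first.
    by apply/funext => x /=; case: (f x) (g x) => [a b] [c d].
  by apply: measurable_funB; exact: measurable_funM.
- rewrite (_ : (fun _ => _) = (fun x => complex.Re (f x) * complex.Im (g x)) \+
     (fun x => complex.Im (f x) * complex.Re (g x))); last first.
    by apply/funext => x /=; case: (f x) (g x) => [a b] [c d].
  by apply: measurable_funD; exact: measurable_funM.
Qed.

Lemma cmeasurable_funB {R : realType} (D : set R) (f g : R -> R[i]) :
  cmeasurable_fun D f -> cmeasurable_fun D g ->
  cmeasurable_fun D (fun x => f x - g x).
Proof.
move=> [fr fi] [gr gi]; split.
- rewrite (_ : (fun _ => _) =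
     (fun x => complex.Re (f x)) \- (fun x => complex.Re (g x))); last first.
    by apply/funext => x /=; case: (f x) (g x) => [a b] [c d].
  exact: measurable_funB.
- rewrite (_ : (fun _ => _) =
     (fun x => complex.Im (f x)) \- (fun x => complex.Im (g x))); last first.
    by apply/funext => x /=; case: (f x) (g x) => [a b] [c d].
  exact: measurable_funB.
Qed.

Lemma measurable_nrm1 {R : realType} (D : set R) (f : R -> R[i]) :
  cmeasurable_fun D f -> measurable_fun D (fun x => nrm1 (f x)).
Proof. by move=> [fr fi]; apply: measurable_funD; exact: measurableT_comp. Qed.

Lemma nrm1_cintegral {R : realType} (D : set R) (f : R -> R[i]) :
  measurable D -> cmeasurable_fun D f ->
  ((nrm1 (cintegral D f))%:E <=
   \int[lebesgue_measure]_(x in D) (nrm1 (f x))%:E)%E.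
Proof.
move=> mD [fr fi]; rewrite /nrm1 EFinD.
under eq_integral do rewrite EFinD.
rewrite ge0_integralD//; try by apply/measurable_EFinP; exact: measurableT_comp.
have norm_Rint (h : R -> R) : measurable_fun D h ->
  ((`|\int[lebesgue_measure]_(x in D) h x|%R)%:E <=
   \int[lebesgue_measure]_(x in D) (`|h x|%R)%:E)%E.
  move=> mh; apply: (@le_trans _ _ `|\int[lebesgue_measure]_(x in D) (h x)%:E|%E).
    (* The real integral takes the default value 0 when the extended one is infinite, so the bound
       covers divergent integrals too. *)
    by rewrite /Rintegral; case: integral => [s||] //=; rewrite normr0 leey.
  by apply: le_trans (le_abse_integral _ _ _) _ => //; exact/measurable_EFinP.
by apply: leeD; exact: norm_Rint.
Qed.

(** On divergent integrals [cintegral] falls back to 0 in the component concerned, and additivity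
    can fail; this predicate guards [cintegralB]. *)
Definition cintegrable {R : realType} (D : set R) (f : R -> R[i]) : Prop :=
  lebesgue_measure.-integrable D (fun x => (complex.Re (f x))%:E) /\
  lebesgue_measure.-integrable D (fun x => (complex.Im (f x))%:E).

Lemma cintegrable_nrm1 {R : realType} (D : set R) (f : R -> R[i]) :
  measurable D -> cmeasurable_fun D f ->
  (\int[lebesgue_measure]_(x in D) (nrm1 (f x))%:E < +oo)%E ->
  cintegrable D f.
Proof.
move=> mD mf fy; have mn : measurable_fun D (fun x => (nrm1 (f x))%:E).
  by apply/measurable_EFinP; exact: measurable_nrm1.
case: mf => fr fi.
split; apply/integrableP; split; try exact/measurable_EFinP.
- apply: le_lt_trans fy; apply: ge0_le_integral => //.
  + by apply: measurableT_comp => //; exact/measurable_EFinP.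
  + by move=> x _; rewrite abse_EFin lee_fin lerDl.
- apply: le_lt_trans fy; apply: ge0_le_integral => //.
  + by apply: measurableT_comp => //; exact/measurable_EFinP.
  + by move=> x _; rewrite abse_EFin lee_fin lerDr.
Qed.

Lemma cintegralB {R : realType} (D : set R) (f g : R -> R[i]) :
  measurable D -> cintegrable D f -> cintegrable D g ->
  cintegral D (fun x => f x - g x) = cintegral D f - cintegral D g.
Proof.
move=> mD [fr fi] [gr gi]; rewrite /cintegral.
have -> (a b c d : R) : (Complex a b) - (Complex c d) = Complex (a - c) (b - d) by [].
rewrite -!RintegralB//.
by congr Complex; apply: eq_Rintegral => x _ ; case: (f x) (g x) => [a b] [c d].
Qed.

(** * Weighted convolution *)

Lemma measurable_Ipi {R : realType} : measurable (@Ipi R).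
Proof. exact: measurable_itv. Qed.

(** Tonelli's theorem applies to the positive and the negative part separately. Default values take
    care of sections that are not integrable. *)
Lemma measurable_fun_Rintegral {R : realType} (h : R * R -> R) :
  measurable_fun setT h ->
  measurable_fun setT (fun x => \int[lebesgue_measure]_t h (x, t)).
Proof.
move=> mh; apply: measurableT_comp; first exact: fine_measurable.
have mE : measurable_fun setT (EFin \o h) by exact/measurable_EFinP.
under eq_fun do rewrite integralE.
apply: emeasurable_funB.
- have := measurable_fun_fubini_tonelli_F (m2 := lebesgue_measure)
    (EFin \o h)^\+%E (measurable_funepos mE).
  rewrite /fubini_F => /(_ (fun z => funepos_ge0 _ z)).
  by congr (measurable_fun setT _); apply/funext => x; apply: eq_integral => t _;
    rewrite !funeposE.
- have := measurable_fun_fubini_tonelli_F (m2 := lebesgue_measure)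
    (EFin \o h)^\-%E (measurable_funeneg mE).
  rewrite /fubini_F => /(_ (fun z => funeneg_ge0 _ z)).
  by congr (measurable_fun setT _); apply/funext => x; apply: eq_integral => t _;
    rewrite !funenegE.
Qed.

Definition zext {R : realType} (f : R -> R[i]) : R -> R[i] :=
  fun x => if x \in Ipi then f x else 0.

(* [conv] alone would denote the convex combinations of mathcomp-analysis.
   Extending by zero turns [Defs.conv] into an integral over a fixed domain, to which
   Tonelli's theorem applies. *)
Lemma conv_restrict {R : realType} (f g : R -> R[i]) (x : R) : Ipi x ->
  Defs.conv f g x = cintegral setT (fun t => zext f (x - t) * zext g t).
Proof.
rewrite /Ipi/= in_itv/= => /andP[x0 xpi].
have E (p : R[i] -> R) (p0 : p 0 = 0) :
    (fun t => p (f (x - t) * g t)) \_ `]0, x[ =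
    (fun t => p (zext f (x - t) * zext g t)).
  have inIpi y : (y \in @Ipi R) = (0 < y < pi).
    by apply/idP/idP; rewrite inE /Ipi/= in_itv.
  apply/funext => t; rewrite patchE /zext !inIpi.
  have -> : (t \in `]0, x[%classic) = (0 < t < x).
    by apply/idP/idP; rewrite inE/= in_itv.
  case: ifPn => [/andP[t0 tx]|tx].
    by rewrite subr_gt0 tx t0 (lt_trans tx xpi) ltrBlDr ltr_wpDr// ltW.
  case: ifPn => [|_]; last by rewrite mul0r p0.
  rewrite subr_gt0 => /andP[tx' _]; move: tx; rewrite tx' andbT => /negbTE->/=.
  by rewrite mulr0 p0.
by rewrite /Defs.conv /cintegral; congr Complex; rewrite Rintegral_mkcond E.
Qed.

Lemma cmeasurable_zext {R : realType} (f : R -> R[i]) :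
  cmeasurable_fun Ipi f -> cmeasurable_fun setT (zext f).
Proof.
have mD := @measurable_Ipi R; move=> [fr fi]; split.
- rewrite (_ : (fun _ => _) = (fun x => complex.Re (f x)) \_ Ipi).
    exact/(measurable_restrictT _ _).1.
  by apply/funext => x; rewrite patchE /zext; case: ifP.
- rewrite (_ : (fun _ => _) = (fun x => complex.Im (f x)) \_ Ipi).
    exact/(measurable_restrictT _ _).1.
  by apply/funext => x; rewrite patchE /zext; case: ifP.
Qed.

(** On [Ipi] the convolution is a parametric integral over the whole line of a jointly measurable
    function, whose real and imaginary parts are expanded into products. *)
Lemma cmeasurable_conv {R : realType} (f g : R -> R[i]) :
  cmeasurable_fun Ipi f -> cmeasurable_fun Ipi g ->
  cmeasurable_fun Ipi (Defs.conv f g).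
Proof.
move=> /cmeasurable_zext[fr fi].
move=> /cmeasurable_zext[gr gi].
have mf1 (h : R -> R) : measurable_fun setT h ->
    measurable_fun setT (fun z : R * R => h (z.1 - z.2)).
  exact: measurable_fun_conv_shift.
have mg1 (h : R -> R) : measurable_fun setT h ->
    measurable_fun setT (fun z : R * R => h z.2).
  by move=> mh; apply: (measurableT_comp mh); exact: measurable_snd.
split.
- pose h z := complex.Re (zext f (z.1 - z.2) * zext g z.2).
  apply: (@eq_measurable_fun _ _ _ _ _
      (fun x => \int[lebesgue_measure]_t h (x, t))).
    by move=> x /set_mem Ix; rewrite conv_restrict.
  apply: measurable_funTS; apply: measurable_fun_Rintegral; rewrite /h.
  rewrite (_ : (fun _ => _) =
      (fun z => complex.Re (zext f (z.1 - z.2)) * complex.Re (zext g z.2)) \-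
      (fun z => complex.Im (zext f (z.1 - z.2)) * complex.Im (zext g z.2))).
    by apply: measurable_funB; apply: measurable_funM;
      [exact: (mf1 _ fr)|exact: (mg1 _ gr)|exact: (mf1 _ fi)|exact: (mg1 _ gi)].
  by apply/funext => z /=; case: (zext _ _) (zext _ _) => [? ?] [? ?].
- pose h z := complex.Im (zext f (z.1 - z.2) * zext g z.2).
  apply: (@eq_measurable_fun _ _ _ _ _
      (fun x => \int[lebesgue_measure]_t h (x, t))).
    by move=> x /set_mem Ix; rewrite conv_restrict.
  apply: measurable_funTS; apply: measurable_fun_Rintegral; rewrite /h.
  rewrite (_ : (fun _ => _) =
      (fun z => complex.Re (zext f (z.1 - z.2)) * complex.Im (zext g z.2)) \+
      (fun z => complex.Im (zext f (z.1 - z.2)) * complex.Re (zext g z.2))).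
    by apply: measurable_funD; apply: measurable_funM;
      [exact: (mf1 _ fr)|exact: (mg1 _ gi)|exact: (mf1 _ fi)|exact: (mg1 _ gr)].
  by apply/funext => z /=; case: (zext _ _) (zext _ _) => [? ?] [? ?].
Qed.

(** The exponent [n] is meant to be the convolution power that [f] stands for. The end [b] moves
    only in the continuity argument of the a priori bound; [lam] is finally chosen from [r]
    alone. *)
Definition wt {R : realType} (lam b : R) (n : nat) (f : R -> R[i]) : R -> \bar R :=
  (fun x => (expR (- (lam * x)) * (pi - x) ^+ n * nrm1 (f x))%:E) \_ `]0, b[%classic.

Lemma wtE {R : realType} (lam b : R) n (f : R -> R[i]) (x : R) : 0 < x < b ->
  wt lam b n f x = (expR (- (lam * x)) * (pi - x) ^+ n * nrm1 (f x))%:E.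
Proof. by move=> xb; rewrite /wt patchE mem_set//= in_itv/=. Qed.

Lemma wt_off {R : realType} (lam b : R) n (f : R -> R[i]) (x : R) : ~~ (0 < x < b) ->
  wt lam b n f x = 0%E.
Proof. by move=> xb; rewrite /wt patchE memNset//= in_itv/=; exact/negP. Qed.

Lemma wt_ge0 {R : realType} (lam b : R) n (f : R -> R[i]) (x : R) : b <= pi ->
  (0 <= wt lam b n f x)%E.
Proof.
move=> bpi; have [xb|/wt_off->//] := boolP (0 < x < b).
rewrite wtE// lee_fin !mulr_ge0 ?expR_ge0 ?nrm1_ge0// exprn_ge0// subr_ge0.
by case/andP: xb => _ /ltW/le_trans; apply.
Qed.

Lemma sub_Ipi {R : realType} (b : R) : b <= pi -> `]0, b[ `<=` (@Ipi R).
Proof.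
move=> bpi x; rewrite /Ipi/= !in_itv/= => /andP[-> xb]/=.
exact: lt_le_trans xb bpi.
Qed.

Lemma measurable_wt {R : realType} (lam b : R) n (f : R -> R[i]) : b <= pi ->
  cmeasurable_fun Ipi f -> measurable_fun setT (wt lam b n f).
Proof.
move=> bpi mf; apply/(measurable_restrictT _ _).1 => //.
apply/measurable_EFinP; apply: measurable_funM.
  apply: measurable_funM.
    apply: measurableT_comp; first exact: measurable_expR.
    by apply: measurable_funN; exact: mulrl_measurable.
  by apply: measurable_funX; exact: measurable_fun_rsub.
apply: measurable_nrm1; apply: cmeasurable_funS mf; first exact: measurable_Ipi.
exact: sub_Ipi.
Qed.

Lemma cmeasurable_conv_integrand {R : realType} (f g : R -> R[i]) (x : R) :
  x <= pi -> cmeasurable_fun Ipi f -> cmeasurable_fun Ipi g ->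
  cmeasurable_fun `]0, x[ (fun t => f (x - t) * g t).
Proof.
move=> xpi [fr fi] mg; apply: cmeasurable_funM; last first.
  by apply: cmeasurable_funS mg; [exact: measurable_Ipi|exact: sub_Ipi].
have mx : measurable_fun `]0, x[ (fun t => x - t) by exact: measurable_fun_rsub.
have sx : [set x - t | t in `]0, x[%classic] `<=` Ipi.
  move=> _ [t + <-]; rewrite /Ipi/= !in_itv/= => /andP[t0 tx].
  rewrite subr_gt0 tx/= (lt_le_trans _ xpi)// ltrBlDr ltrDl//.
split.
- exact: (measurable_comp measurable_Ipi sx fr mx).
- exact: (measurable_comp measurable_Ipi sx fi mx).
Qed.

(* Each of [pi - (x - t)] and [pi - t] is at least [pi - x]. *)
Lemma wt_conv_kernel {R : realType} (lam b : R) m n (f g : R -> R[i]) (x : R) :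
  b <= pi -> cmeasurable_fun Ipi f -> cmeasurable_fun Ipi g -> 0 < x < b ->
  ((expR (- (lam * x)) * (pi - x) ^+ (m + n))%:E *
   \int[lebesgue_measure]_(t in `]0%R, x[) (nrm1 (f (x - t) * g t))%:E <=
   pconv (wt lam b m f) (wt lam b n g) x)%E.
Proof.
move=> bpi mf mg /[dup] xb /andP[x0 ltxb].
have xpi : x <= pi by rewrite (le_trans _ bpi)// ltW.
have px0 : 0 <= pi - x by rewrite subr_ge0.
have mh : measurable_fun `]0, x[ (fun t => (nrm1 (f (x - t) * g t))%:E).
  apply/measurable_EFinP; apply: measurable_nrm1.
  exact: cmeasurable_conv_integrand.
rewrite -ge0_integralZl//; last 2 first.
- by move=> t _; rewrite lee_fin nrm1_ge0.
- by rewrite lee_fin mulr_ge0 ?expR_ge0 ?exprn_ge0.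
have mI : measurable_fun setT (fun t : R => wt lam b m f (x - t)%R * wt lam b n g t)%E.
  by apply: measurable_pconv1; exact: measurable_wt.
have I0 t : (0 <= wt lam b m f (x - t)%R * wt lam b n g t)%E.
  by rewrite mule_ge0 ?wt_ge0.
apply: (@le_trans _ _ (\int[lebesgue_measure]_(t in `]0%R, x[)
    (wt lam b m f (x - t)%R * wt lam b n g t))%E); last first.
  by apply: ge0_subset_integral => //.
apply: ge0_le_integral => //.
- by move=> t _; rewrite mule_ge0// lee_fin ?nrm1_ge0// mulr_ge0 ?expR_ge0 ?exprn_ge0.
- by apply: emeasurable_funM => //; exact: mh.
- exact: measurable_funS mI.
move=> t; rewrite /= in_itv/= => /andP[t0 tx].
rewrite !wtE; last 2 first.
- by rewrite t0 (lt_trans tx).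
- by rewrite subr_gt0 tx ltrBlDr (lt_trans ltxb)// ltrDl.
rewrite -!EFinM lee_fin.
have -> : - (lam * x) = - (lam * (x - t)) + - (lam * t) by ring.
rewrite expRD exprD.
set u := expR _; set v := expR _.
rewrite (_ : u * v * _ * _ = (u * v) * (((pi - x) ^+ m * (pi - x) ^+ n) *
    nrm1 (f (x - t) * g t))); last by ring.
rewrite (_ : u * _ * _ * _ = (u * v) * (((pi - (x - t)) ^+ m * (pi - t) ^+ n) *
    (nrm1 (f (x - t)) * nrm1 (g t)))); last by ring.
rewrite ler_wpM2l ?mulr_ge0 ?expR_ge0//.
apply: ler_pM; rewrite ?mulr_ge0 ?exprn_ge0 ?nrm1_ge0 ?nrm1M//.
rewrite ler_pM ?exprn_ge0// lerXn2r ?nnegrE//; try lra.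
Qed.

(** Moving the norm inside the integral leaves [wt_conv_kernel], which is kept separate because it
    also yields the integrability in [cintegrable_conv]. *)
Lemma wt_conv {R : realType} (lam b : R) m n (f g : R -> R[i]) (x : R) :
  b <= pi -> cmeasurable_fun Ipi f -> cmeasurable_fun Ipi g ->
  (wt lam b (m + n) (Defs.conv f g) x <= pconv (wt lam b m f) (wt lam b n g) x)%E.
Proof.
move=> bpi mf mg; have [xb|/wt_off->] := boolP (0 < x < b); last first.
  by apply: pconv_ge0 => y; exact: wt_ge0.
apply: le_trans (wt_conv_kernel _ _ _ bpi mf mg xb).
have xpi : x <= pi by rewrite (le_trans _ bpi)// ltW//; case/andP: xb.
rewrite wtE// EFinM lee_wpmul2l//.
  by rewrite lee_fin mulr_ge0 ?expR_ge0 ?exprn_ge0// subr_ge0.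
by apply: nrm1_cintegral => //; exact: cmeasurable_conv_integrand.
Qed.

Lemma cmeasurable_convpow {R : realType} (N : R -> R[i]) n :
  cmeasurable_fun Ipi N -> cmeasurable_fun Ipi (convpow N n).
Proof.
by move=> mN; case: n => [|n]//; elim: n => // n ih; exact: cmeasurable_conv.
Qed.

Lemma integral_wt_ge0 {R : realType} (lam b : R) n (f : R -> R[i]) : b <= pi ->
  (0 <= J (wt lam b n f))%E.
Proof. by move=> bpi; apply: integral_ge0 => x _; exact: wt_ge0. Qed.

Lemma integral_wt_conv {R : realType} (lam b : R) m n (f g : R -> R[i]) :
  b <= pi -> cmeasurable_fun Ipi f -> cmeasurable_fun Ipi g ->
  (J (wt lam b (m + n) (Defs.conv f g)) <= J (wt lam b m f) * J (wt lam b n g))%E.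
Proof.
move=> bpi mf mg; rewrite -integral_pconv; try exact: measurable_wt;
  try by move=> x; exact: wt_ge0.
apply: ge0_le_integral => //.
- by move=> x _; exact: wt_ge0.
- by apply: measurable_wt => //; exact: cmeasurable_conv.
- by apply: measurable_pconv => [||x|x]; try exact: measurable_wt; exact: wt_ge0.
- by move=> x _; exact: wt_conv.
Qed.

(** Induction on the power: every further factor [N] absorbs one power of [pi - x] and contributes
    one factor [s]. *)
Lemma integral_wt_convpow {R : realType} (lam b s : R) (N : R -> R[i]) n :
  b <= pi -> cmeasurable_fun Ipi N -> (J (wt lam b 1 N) <= s%:E)%E ->
  (J (wt lam b n.+1 (convpow N n.+1)) <= (s ^+ n.+1)%:E)%E.
Proof.
move=> bpi mN Ns; elim: n => [|n ih]; first by rewrite expr1.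
apply: le_trans (integral_wt_conv lam 1 n.+1 bpi mN (cmeasurable_convpow n.+1 mN)) _.
by rewrite exprS EFinM lee_pmul// integral_wt_ge0.
Qed.

Lemma convBl {R : realType} (f f' g : R -> R[i]) (x : R) :
  cintegrable `]0, x[ (fun t => f (x - t) * g t) ->
  cintegrable `]0, x[ (fun t => f' (x - t) * g t) ->
  Defs.conv f g x - Defs.conv f' g x = Defs.conv (fun y => f y - f' y) g x.
Proof.
move=> If If'; rewrite /Defs.conv -cintegralB//.
by congr cintegral; apply/funext => t; rewrite mulrBl.
Qed.

Lemma convBr {R : realType} (f g g' : R -> R[i]) (x : R) :
  cintegrable `]0, x[ (fun t => f (x - t) * g t) ->
  cintegrable `]0, x[ (fun t => f (x - t) * g' t) ->
  Defs.conv f g x - Defs.conv f g' x = Defs.conv f (fun y => g y - g' y) x.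
Proof.
move=> If If'; rewrite /Defs.conv -cintegralB//.
by congr cintegral; apply/funext => t; rewrite mulrBr.
Qed.

(** The weight at [x] is strictly positive, so by [wt_conv_kernel] an infinite integral would make
    the right-hand convolution infinite as well. *)
Lemma cintegrable_conv {R : realType} (lam b : R) m n (f g : R -> R[i]) (x : R) :
  b <= pi -> cmeasurable_fun Ipi f -> cmeasurable_fun Ipi g -> 0 < x < b ->
  (pconv (wt lam b m f) (wt lam b n g) x < +oo)%E ->
  cintegrable `]0, x[ (fun t => f (x - t) * g t).
Proof.
move=> bpi mf mg xb fy; have /andP[x0 ltxb] := xb.
have xpi : x < pi by rewrite (lt_le_trans ltxb).
apply: cintegrable_nrm1 => //.
  by apply: cmeasurable_conv_integrand => //; exact: ltW.
have := le_lt_trans (wt_conv_kernel lam m n bpi mf mg xb) fy.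
set I := integral _ _ _.
have I0 : (0 <= I)%E by apply: integral_ge0 => t _; rewrite lee_fin nrm1_ge0.
case: (I) I0 => [u _ _|_|//]; first by rewrite ltry.
rewrite gt0_muley// lte_fin.
by rewrite mulr_gt0 ?expR_gt0// exprn_gt0// subr_gt0.
Qed.

Lemma ae_pconv_fin {R : realType} (F G : R -> \bar R) :
  measurable_fun setT F -> measurable_fun setT G ->
  (forall x, 0 <= F x)%E -> (forall x, 0 <= G x)%E ->
  (J F < +oo)%E -> (J G < +oo)%E ->
  {ae lebesgue_measure, forall x, (pconv F G x < +oo)%E}.
Proof.
move=> mF mG F0 G0 Fy Gy.
have : lebesgue_measure.-integrable setT (pconv F G).
  apply/integrableP; split; first exact: measurable_pconv.
  under eq_integral do rewrite gee0_abs ?pconv_ge0//.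
  rewrite integral_pconv// lte_mul_pinfty ?integral_ge0//.
  by rewrite ge0_fin_numE// integral_ge0.
move=> /integrable_ae => /(_ measurableT); apply: filterS => x /(_ I).
by rewrite ge0_fin_numE// pconv_ge0.
Qed.

(** Convolution is bilinear, so the difference is that of [f] and [f'] convolved with [g], plus [f']
    convolved with that of [g] and [g']. This holds only where the convolutions of [f] with [g], of
    [f'] with [g], and of [f'] with [g'] all converge absolutely, hence almost everywhere. *)
Lemma wt_conv_diff {R : realType} (lam b : R) m n (f f' g g' : R -> R[i]) :
  b <= pi ->
  cmeasurable_fun Ipi f -> cmeasurable_fun Ipi f' ->
  cmeasurable_fun Ipi g -> cmeasurable_fun Ipi g' ->
  (J (wt lam b m f) < +oo)%E -> (J (wt lam b m f') < +oo)%E ->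
  (J (wt lam b n g) < +oo)%E -> (J (wt lam b n g') < +oo)%E ->
  {ae lebesgue_measure, forall x,
    (wt lam b (m + n) (fun y => Defs.conv f g y - Defs.conv f' g' y)%R x <=
     pconv (wt lam b m (fun y => f y - f' y)%R) (wt lam b n g) x +
     pconv (wt lam b m f') (wt lam b n (fun y => g y - g' y)%R) x)%E}.
Proof.
move=> bpi mf mf' mg mg' fy fy' gy gy'.
have ae_fin p q p' q' := @ae_pconv_fin R _ _ (measurable_wt lam p bpi p')
  (measurable_wt lam q bpi q') (fun x => wt_ge0 _ _ _ _ bpi)
  (fun x => wt_ge0 _ _ _ _ bpi).
have := ae_fin _ _ m n mf mg fy gy.
have := ae_fin _ _ m n mf' mg fy' gy.
have := ae_fin _ _ m n mf' mg' fy' gy'.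
apply: filterS3 => x f'g' f'g fg.
have [xb|/wt_off->] := boolP (0 < x < b); last first.
  by rewrite adde_ge0// pconv_ge0// => ?; exact: wt_ge0.
have Ifg := cintegrable_conv bpi mf mg xb fg.
have If'g := cintegrable_conv bpi mf' mg xb f'g.
have If'g' := cintegrable_conv bpi mf' mg' xb f'g'.
have mff' := cmeasurable_funB mf mf'; have mgg' := cmeasurable_funB mg mg'.
apply: le_trans (leeD (wt_conv lam m n x bpi mff' mg) (wt_conv lam m n x bpi mf' mgg')).
rewrite !wtE// -EFinD lee_fin -mulrDr ler_wpM2l//.
  rewrite mulr_ge0 ?expR_ge0// exprn_ge0// subr_ge0.
  by case/andP: xb => _ /ltW/le_trans; apply.
rewrite -convBl// -convBr//; apply: le_trans (nrm1D _ _).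
by rewrite addrA subrK.
Qed.

(** * Isolating the first term of the series *)

(** The equation is solved for its first term. The right-hand side may be infinite, so only
    convergence of the series itself, not absolute convergence, is assumed. *)
Lemma series_cvg_head {R : realType} (z : nat -> R[i]) (u : R[i]) :
  (\sum_(1 <= nu < n.+1) z nu : R[i]^o) @[n --> \oo] --> (u : R[i]^o) ->
  ((nrm1 (z 1%N))%:E <= (nrm1 u)%:E + \sum_(0 <= k <oo) (nrm1 (z k.+2))%:E)%E.
Proof.
move=> /cvgrPdist_lt zu; apply/lee_addgt0Pr => e e0.
(* Convergence is measured by the modulus, and [nrm1] is at most twice the modulus. *)
have e20 : 0 < ((e / 2)%:C)%C :> R[i] by rewrite ltcR divr_gt0.
(* The index [n.+1] makes the partial sum nonempty, so that its first term can be split off. *)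
have [n _ /(_ n.+1 (leqnSn n))] := zu _ e20.
rewrite big_ltn//= => dist.
have {}dist : nrm1 (u - (z 1%N + \sum_(2 <= i < n.+2) z i)) <= e.
  apply: le_trans (nrm1_le_normc _) _.
  by move: dist; rewrite normc_def; set s := complex.Re _; set t := complex.Im _;
    rewrite ltcR => d; case: (_ - _) @s @t d => a b /= d; lra.
set S := \sum_(2 <= i < n.+2) z i in dist.
have zS : nrm1 (z 1%N) <= nrm1 u + nrm1 S + e.
  have -> : z 1%N = u + - (u - (z 1%N + S)) + - S by ring.
  have := nrm1D (u + - (u - (z 1%N + S))) (- S).
  have := nrm1D u (- (u - (z 1%N + S))).
  rewrite !nrm1N; lra.
have SB : ((nrm1 S)%:E <= \sum_(0 <= k <oo) (nrm1 (z k.+2))%:E)%E.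
  apply: (@le_trans _ _ (\sum_(0 <= k < n) (nrm1 (z k.+2))%:E)%E); last first.
    by apply: nneseries_lim_ge => k _ _; rewrite lee_fin nrm1_ge0.
  rewrite sumEFin lee_fin /S -[2%N]add0n -[n.+2]addn2 big_addn addnK.
  elim/big_rec2 : _ => [|i a b _ ih]; first by rewrite /nrm1 /= normr0 addr0.
  by rewrite addn2 (le_trans (nrm1D _ _))// lerD2l.
apply: (@le_trans _ _ ((nrm1 u)%:E + (nrm1 S)%:E + e%:E)%E).
  by rewrite -!EFinD lee_fin.
by rewrite leeD2r// leeD2l.
Qed.

(** Stated for general coefficients [A], since it serves both the powers of one solution and the
    differences of the powers of two. *)
Lemma wt_series_head {R : realType} (lam b : R) (A : nat -> R -> R[i])
    (u : R -> R[i]) : b <= pi ->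
  {ae lebesgue_measure, forall x : R, Ipi x ->
    (\sum_(1 <= nu < n.+1) (((pi - x) ^+ nu / nu`!%:R)%:C)%C * A nu x : R[i]^o)
      @[n --> \oo] --> (u x : R[i]^o)} ->
  {ae lebesgue_measure, forall x,
    (wt lam b 1 (A 1%N) x <= wt lam b 0 u x +
     \sum_(0 <= k <oo) (k.+2`!%:R^-1)%:E * wt lam b k.+2 (A k.+2) x)%E}.
Proof.
move=> bpi; apply: filterS => x cvgx.
have [xb|xb] := boolP (0 < x < b); last first.
  rewrite !wt_off// add0e nneseries_ge0// => k _ _.
  by rewrite mule_ge0 ?wt_ge0// lee_fin invr_ge0.
have Ix : Ipi x by apply: (sub_Ipi bpi); rewrite /= in_itv.
have px : 0 <= pi - x.
  by move: Ix; rewrite /Ipi/= in_itv/= subr_ge0 => /andP[_ /ltW].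
have e0 := expR_ge0 (- (lam * x)).
have := series_cvg_head (cvgx Ix).
rewrite !wtE// expr0 mulr1 expr1 (_ : 1`! = 1%N)// divr1 nrm1_scale// => H.
rewrite -mulrA [leLHS]EFinM.
apply: (le_trans (lee_wpmul2l _ H)); first by rewrite lee_fin.
rewrite ge0_muleDr ?lee_fin ?nrm1_ge0//; last first.
  by apply: nneseries_ge0 => k _ _; rewrite lee_fin nrm1_ge0.
rewrite -EFinM leeD2l// -nneseriesZl//; last first.
  by move=> k _; rewrite lee_fin nrm1_ge0.
apply: lee_nneseries => [k _ _|k _].
  by rewrite mule_ge0 ?lee_fin ?nrm1_ge0.
rewrite wtE// -!EFinM lee_fin nrm1_scale ?divr_ge0 ?exprn_ge0//.
rewrite le_eqVlt; apply/orP; left; apply/eqP; ring.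
Qed.

(** The ratio 1/4 is the a priori bound on the weighted norm of a solution; the sum 1/3 becomes the
    contraction factor of the stability argument. *)
Lemma geometric_quarter_le {R : realType} (c : R) : 0 <= c ->
  (\sum_(0 <= k <oo) (c * (1 / 4) ^+ k.+1)%:E <= (c / 3)%:E)%E.
Proof.
move=> c0; apply: lime_le.
  by apply: is_cvg_nneseries => k _ _; rewrite lee_fin mulr_ge0// exprn_ge0// divr_ge0.
apply: nearW => n; rewrite sumEFin lee_fin.
suff -> : \sum_(0 <= k < n) c * (1 / 4) ^+ k.+1 = c / 3 * (1 - (1 / 4) ^+ n).
  rewrite ler_piMr ?divr_ge0// gerBl exprn_ge0// divr_ge0//.
elim: n => [|n ih]; first by rewrite big_nil expr0 subrr mulr0.
by rewrite big_nat_recr//= ih exprS; field.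
Qed.

(** * Differences of convolution powers *)

Lemma pconv_le_cstD {R : realType} (F H W : R -> \bar R) (c : R) (x : R) :
  0 <= c ->
  measurable_fun setT F -> measurable_fun setT H -> measurable_fun setT W ->
  (forall y, 0 <= F y)%E -> (forall y, 0 <= H y)%E -> (forall y, 0 <= W y)%E ->
  (forall y, F y <= c%:E + H y)%E ->
  (pconv F W x <= c%:E * J W + pconv H W x)%E.
Proof.
move=> c0 mF mH mW F0 H0 W0 FcH.
have mHW := measurable_pconv1 x mH mW.
have HW0 t : (0 <= H (x - t)%R * W t)%E by rewrite mule_ge0.
have mcW : measurable_fun setT (fun t => c%:E * W t)%E by exact: measurable_funeM.
have cW0 t : (0 <= c%:E * W t)%E by rewrite mule_ge0.
rewrite -ge0_integralZl// /pconv -ge0_integralD//.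
apply: ge0_le_integral => //.
- by move=> t _; rewrite mule_ge0.
- exact: measurable_pconv1.
- exact: emeasurable_funD.
- by move=> t _; rewrite -ge0_muleDl ?lee_fin// lee_wpmul2r.
Qed.

(** Here [F] is evaluated at the integration variable itself, so a bound almost everywhere suffices;
    the reflected [W] has the same integral as [W]. *)
Lemma pconv_ae_le_cstD {R : realType} (F G W : R -> \bar R) (c : R) (x : R) :
  0 <= c ->
  measurable_fun setT F -> measurable_fun setT G -> measurable_fun setT W ->
  (forall y, 0 <= F y)%E -> (forall y, 0 <= G y)%E -> (forall y, 0 <= W y)%E ->
  {ae lebesgue_measure, forall y, (F y <= c%:E + G y)%E} ->
  (pconv W F x <= c%:E * J W + pconv W G x)%E.
Proof.
move=> c0 mF mG mW F0 G0 W0 FcG.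
have mWx : measurable_fun setT (fun t : R => W (x - t)%R).
  by apply: (measurableT_comp mW); exact: measurable_fun_rsub.
have mWG := measurable_pconv1 x mW mG.
have WG0 t : (0 <= W (x - t)%R * G t)%E by rewrite mule_ge0.
have mcW : measurable_fun setT (fun t : R => c%:E * W (x - t)%R)%E.
  exact: measurable_funeM.
have cW0 t : (0 <= c%:E * W (x - t)%R)%E by rewrite mule_ge0.
rewrite -(ge0_integral_rsub x mW)// -ge0_integralZl// /pconv -ge0_integralD//.
apply: ae_ge0_le_integral => //.
- by move=> t _; rewrite mule_ge0.
- exact: measurable_pconv1.
- by move=> t _; rewrite adde_ge0.
- exact: emeasurable_funD.
- apply: filterS FcG => t FcG _.
  by rewrite (muleC c%:E) -ge0_muleDr ?lee_fin// lee_wpmul2l.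
Qed.

(** Telescoping, as for a difference of two ordinary powers. The constant [c] and the remainder
    [phi] are propagated separately: convolving with a function of mass at most [s] multiplies the
    bound on a constant and the bound on an integral alike by [s]. Only the integral of [H] and its
    pointwise role matter later, so [H] stays existential. *)
Lemma wt_convpow_diff {R : realType} (lam b s c p : R) (N N' : R -> R[i])
    (phi : R -> \bar R) n :
  b <= pi -> cmeasurable_fun Ipi N -> cmeasurable_fun Ipi N' ->
  0 <= s -> 0 <= c -> 0 <= p ->
  (J (wt lam b 1 N) <= s%:E)%E -> (J (wt lam b 1 N') <= s%:E)%E ->
  measurable_fun setT phi -> (forall x, 0 <= phi x)%E -> (J phi <= p%:E)%E ->
  (forall x, wt lam b 1 (fun y => N y - N' y)%R x <= c%:E + phi x)%E ->
  exists H : R -> \bar R, [/\ measurable_fun setT H, (forall x, 0 <= H x)%E,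
    (J H <= (n.+1%:R * s ^+ n * p)%:E)%E &
    {ae lebesgue_measure, forall x,
      (wt lam b n.+1 (fun y => convpow N n.+1 y - convpow N' n.+1 y)%R x <=
       (n.+1%:R * s ^+ n * c)%:E + H x)%E}].
Proof.
move=> bpi mN mN' s0 c0 p0 Ns N's mphi phi0 phip Nphi.
elim: n => [|n [H [mH H0 Hp NH]]].
  exists phi; split => //; first by rewrite expr0 !mul1r.
  by apply: aeW => x; rewrite expr0 !mul1r.
have mA := cmeasurable_convpow n.+1 mN; have mA' := cmeasurable_convpow n.+1 mN'.
set A := convpow N n.+1 in mA NH *; set A' := convpow N' n.+1 in mA' NH *.
have As : (J (wt lam b n.+1 A) <= (s ^+ n.+1)%:E)%E by exact: integral_wt_convpow.
have A's : (J (wt lam b n.+1 A') <= (s ^+ n.+1)%:E)%E by exact: integral_wt_convpow.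
have mwt k f (mf : cmeasurable_fun Ipi f) := measurable_wt lam k bpi mf.
have wt0 k f x := wt_ge0 lam k f x bpi.
have phiA := measurable_pconv mphi (mwt n.+1 _ mA) phi0 (wt0 _ _).
have N'H := measurable_pconv (mwt 1%N _ mN') mH (wt0 _ _) H0.
have phiA0 := pconv_ge0 phi0 (wt0 n.+1 A).
have N'H0 := pconv_ge0 (wt0 1%N N') H0.
have sn0 : 0 <= s ^+ n by rewrite exprn_ge0.
exists (fun x => pconv phi (wt lam b n.+1 A) x + pconv (wt lam b 1 N') H x)%E.
split.
- exact: emeasurable_funD.
- by move=> x; rewrite adde_ge0.
- have Jphi0 : (0 <= J phi)%E by exact: integral_ge0.
  have JH0 : (0 <= J H)%E by exact: integral_ge0.
  rewrite ge0_integralD// !integral_pconv//; try exact: mwt.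
  apply: (@le_trans _ _ (p%:E * (s ^+ n.+1)%:E +
      s%:E * (n.+1%:R * s ^+ n * p)%:E)%E).
    apply: leeD.
      exact: (lee_pmul Jphi0 (integral_wt_ge0 _ _ _ bpi) phip As).
    exact: (lee_pmul (integral_wt_ge0 _ _ _ bpi) JH0 N's Hp).
  rewrite -!EFinM -EFinD lee_fin exprS -[n.+2]addn1 natrD.
  by rewrite le_eqVlt; apply/orP; left; apply/eqP; ring.
- have lty q : (q%:E < +oo :> \bar R)%E by rewrite ltry.
  have := wt_conv_diff bpi mN mN' mA mA' (le_lt_trans Ns (lty _))
    (le_lt_trans N's (lty _)) (le_lt_trans As (lty _)) (le_lt_trans A's (lty _)).
  apply: filterS => x; rewrite add1n => /le_trans; apply.
  have k0 : 0 <= n.+1%:R * s ^+ n * c by rewrite !mulr_ge0.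
  have mNN' := cmeasurable_funB mN mN'; have mAA' := cmeasurable_funB mA mA'.
  have := pconv_le_cstD x c0 (mwt 1%N _ mNN') mphi (mwt n.+1 _ mA) (wt0 _ _) phi0
    (wt0 _ _) Nphi.
  have := pconv_ae_le_cstD x k0 (mwt n.+1 _ mAA') mH (mwt 1%N _ mN') (wt0 _ _) H0
    (wt0 _ _) NH.
  move=> le1 le2; apply: (le_trans (leeD le2 le1)).
  rewrite addeACA leeD2r//.
  apply: (@le_trans _ _ (c%:E * (s ^+ n.+1)%:E +
      (n.+1%:R * s ^+ n * c)%:E * s%:E)%E).
    have cE : (0 <= c%:E)%E by rewrite lee_fin.
    have kE : (0 <= (n.+1%:R * s ^+ n * c)%:E)%E by rewrite lee_fin.
    exact: (leeD (lee_wpmul2l cE As) (lee_wpmul2l kE N's)).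
  rewrite -!EFinM -EFinD lee_fin exprS -[n.+2]addn1 natrD.
  by rewrite le_eqVlt; apply/orP; left; apply/eqP; ring.
Qed.

Lemma solution_diff_cvg {R : realType} (w w' N N' : R -> R[i]) :
  is_solution w N -> is_solution w' N' ->
  {ae lebesgue_measure, forall x : R, Ipi x ->
    (\sum_(1 <= nu < n.+1) (((pi - x) ^+ nu / nu`!%:R)%:C)%C *
        (convpow N nu x - convpow N' nu x) : R[i]^o)
      @[n --> \oo] --> (w (pi - x) - w' (pi - x) : R[i]^o)}.
Proof.
apply: filterS2 => x cN cN' Ix.
set S := (X in fmap X _).
pose SN n : R[i]^o := \sum_(1 <= nu < n.+1)
  (((pi - x) ^+ nu / nu`!%:R)%:C)%C * convpow N nu x.
pose SN' n : R[i]^o := \sum_(1 <= nu < n.+1)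
  (((pi - x) ^+ nu / nu`!%:R)%:C)%C * convpow N' nu x.
have -> : S = SN \- SN'.
  apply/funext => n; rewrite /S /SN /SN'/= -sumrB.
  by apply: eq_bigr => nu _; rewrite mulrBr.
exact: (cvgB (cN Ix) (cN' Ix)).
Qed.

Lemma succ_le_fact n : (n.+1 <= n.+1`!)%N.
Proof. by rewrite factS leq_pmulr// fact_gt0. Qed.

Lemma stability_small {R : realType} (lam eps : R) (w w' N N' : R -> R[i]) :
  0 <= lam -> 0 <= eps -> cmeasurable_fun Ipi N -> cmeasurable_fun Ipi N' ->
  is_solution w N -> is_solution w' N' ->
  (J (wt lam pi 1 N) <= (1 / 4)%:E)%E -> (J (wt lam pi 1 N') <= (1 / 4)%:E)%E ->
  {ae lebesgue_measure, forall x : R, Ipi x ->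
    nrm1 (w (pi - x) - w' (pi - x)) <= eps} ->
  {ae lebesgue_measure, forall x : R,
    (wt lam pi 1 (fun y => N y - N' y)%R x <= (2 * eps)%:E)%E}.
Proof.
move=> lam0 eps0 mN mN' solN solN' N4 N'4 ww'.
have mNN' := cmeasurable_funB mN mN'.
pose D := wt lam pi 1 (fun y => N y - N' y).
have mD : measurable_fun setT D by exact: measurable_wt.
have D0 x : (0 <= D x)%E by exact: wt_ge0.
have DN x : (D x <= wt lam pi 1 N x + wt lam pi 1 N' x)%E.
  rewrite /D; have [xb|xb] := boolP (0 < x < pi); last by rewrite !wt_off ?adde0.
  rewrite !wtE// -EFinD lee_fin -mulrDr ler_wpM2l//.
    by rewrite mulr_ge0 ?expR_ge0// expr1 subr_ge0; case/andP: xb => _ /ltW.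
  by rewrite (le_trans (nrm1D _ _))// nrm1N.
(* Chosen so that [eps + c / 3 <= c], where [c / 3] is the contribution of the constant part to the
   terms beyond the first. *)
pose c := 2 * eps; have c0 : 0 <= c by rewrite mulr_ge0.
pose phi x := maxe (D x - c%:E)%E 0%E.
have phi0 x : (0 <= phi x)%E by rewrite /phi le_max lexx orbT.
have mphi : measurable_fun setT phi.
  apply: measurable_maxe; last exact: measurable_cst.
  by apply: emeasurable_funB => //; exact: measurable_cst.
have phiD x : (phi x <= D x)%E.
  by rewrite /phi ge_max D0 andbT leeBlDr// leeDl// lee_fin.
have Dphi x : (D x <= c%:E + phi x)%E.
  by rewrite addeC -leeBlDr// /phi le_max lexx.
(* The final inequality [p <= p / 3] is conclusive only for a finite integral; finiteness comes from
   [phi <= D] and the two bounds by 1/4. *)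
have phi_fin : J phi \is a fin_num.
  rewrite ge0_fin_numE ?integral_ge0//.
  apply: (@le_lt_trans _ _ (J (wt lam pi 1 N) + J (wt lam pi 1 N'))%E).
    rewrite -ge0_integralD//; try exact: measurable_wt;
      try by move=> *; exact: wt_ge0.
    apply: ge0_le_integral => //.
      by apply: emeasurable_funD; exact: measurable_wt.
    by move=> x _; exact: le_trans (phiD x) (DN x).
  by apply: (le_lt_trans (leeD N4 N'4)); rewrite -EFinD ltry.
pose p := fine (J phi); have p0 : 0 <= p by rewrite fine_ge0// integral_ge0.
have phip : J phi = p%:E by rewrite /p fineK.
have q0 : 0 <= 1 / 4 :> R by rewrite divr_ge0.
have /choice[H HP] n := wt_convpow_diff n (lexx pi) mN mN' q0 c0 p0 N4 N'4 mphi phi0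
  (eq_ind_r (fun z => (z <= p%:E)%E) (lexx _) phip) Dphi.
(* Term [k] belongs to the convolution power [k.+2], whose remainder is [H k.+1]. *)
pose K x := (\sum_(0 <= k <oo) (k.+2`!%:R^-1)%:E * H k.+1 x)%E.
have f0 k : 0 <= k.+2`!%:R^-1 :> R by rewrite invr_ge0.
(* The factorial of the series cancels the factor [k.+2] produced by telescoping and leaves a
   geometric series. *)
have fk k (t : R) : 0 <= t -> k.+2`!%:R^-1 * (k.+2%:R * t) <= t.
  move=> t0; rewrite mulrA ler_piMl// mulrC ler_pdivrMr ?ltr0n ?fact_gt0//.
  by rewrite mul1r ler_nat succ_le_fact.
have H0 k x : (0 <= H k x)%E by case: (HP k).
have mH k : measurable_fun setT (H k) by case: (HP k).
have aH0 k x : (0 <= (k.+2`!%:R^-1)%:E * H k.+1 x)%E by rewrite mule_ge0// lee_fin.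
have K0 x : (0 <= K x)%E by apply: nneseries_ge0.
have mK : measurable_fun setT K.
  apply: ge0_emeasurable_sum => //= k _.
  exact: measurable_funeM.
have JK : (J K <= (p / 3)%:E)%E.
  have maH k : measurable_fun setT (fun x => (k.+2`!%:R^-1)%:E * H k.+1 x)%E.
    exact: measurable_funeM.
  rewrite /K integral_nneseries//.
  apply: le_trans (geometric_quarter_le p0).
  apply: lee_nneseries => [k _ _|k _].
    by apply: integral_ge0.
  rewrite ge0_integralZl ?lee_fin//; last exact: mH.
  case: (HP k.+1) => _ _ JH _.
  apply: (le_trans (lee_wpmul2l _ JH)); first by rewrite lee_fin.
  rewrite -EFinM lee_fin -[X in _^-1 * X]mulrA [p * _]mulrC.
  by rewrite fk// mulr_ge0// exprn_ge0.
have DK : {ae lebesgue_measure, forall x, (D x <= c%:E + K x)%E}.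
  have := wt_series_head lam
    (A := fun nu y => convpow N nu y - convpow N' nu y)
    (u := fun y => w (pi - y) - w' (pi - y)) (lexx pi) (solution_diff_cvg solN solN').
  have aeH : {ae lebesgue_measure, forall x k,
    (wt lam pi k.+1 (fun y => convpow N k.+1 y - convpow N' k.+1 y)%R x <=
       (k.+1%:R * (1 / 4) ^+ k * c)%:E + H k x)%E}.
    by apply: ae_foralln => k; case: (HP k).
  move: aeH ww'; apply: filterS3 => x allH ww' head.
  apply: (@le_trans _ _ (eps%:E + (c / 3)%:E + K x)%E); last first.
    rewrite leeD2r// -EFinD lee_fin /c; lra.
  apply: (le_trans head); rewrite -addeA; apply: leeD.
    have [xb|xb] := boolP (0 < x < pi); last by rewrite wt_off.
    rewrite wtE// lee_fin expr0 mulr1.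
    have Ix : Ipi x by rewrite /Ipi/= in_itv.
    have e1 : expR (- (lam * x)) <= 1.
      by rewrite -expR0 ler_expR oppr_le0 mulr_ge0//; case/andP: xb => /ltW.
    rewrite (le_trans _ (ww' Ix))// ler_piMl ?nrm1_ge0//.
  (* Each power contributes a constant part, all of which sum to at most [c / 3], and its share of
     [K]. *)
  apply: (@le_trans _ _ (\sum_(0 <= k <oo) ((c * (1 / 4) ^+ k.+1)%:E +
      (k.+2`!%:R^-1)%:E * H k.+1 x))%E).
    apply: lee_nneseries => [k _ _|k _].
      by rewrite mule_ge0 ?lee_fin ?wt_ge0.
    apply: (le_trans (lee_wpmul2l _ (allH k.+1))); first by rewrite lee_fin.
    rewrite ge0_muleDr ?lee_fin ?mulr_ge0 ?exprn_ge0//.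
    rewrite leeD2r// -EFinM lee_fin -[X in _^-1 * X]mulrA [_ * c]mulrC.
    by rewrite fk// mulr_ge0// exprn_ge0.
  rewrite nneseriesD//; last by move=> k _; rewrite lee_fin mulr_ge0 ?exprn_ge0.
  by rewrite leeD2r// geometric_quarter_le.
have phiK : (J phi <= J K)%E.
  apply: ae_ge0_le_integral => //; apply: filterS DK => x DK _.
  by rewrite /phi ge_max K0 andbT leeBlDr// addeC.
(* A nonnegative real with [p <= p / 3] is 0. *)
have p_eq0 : p = 0.
  by have := le_trans phiK JK; rewrite phip lee_fin; lra.
have : ae_eq lebesgue_measure setT phi (cst 0%E).
  apply/ae_eq_integral_abs => //.
  by under eq_integral do rewrite gee0_abs//; rewrite phip p_eq0.
apply: filterS => x /(_ I) /= phix0.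
by have := Dphi x; rewrite phix0 adde0.
Qed.

(** * The a priori bound *)

(** The power [k.+2] has norm at most [(1 / 4) ^+ k.+2], with the inverse factorials bounded by 1;
    the sum over all [k] is 1/12. *)
Lemma integral_wt_picard {R : realType} (lam b : R) (u N : R -> R[i]) :
  b <= pi -> cmeasurable_fun Ipi N -> cmeasurable_fun Ipi u ->
  {ae lebesgue_measure, forall x : R, Ipi x ->
    (\sum_(1 <= nu < n.+1) (((pi - x) ^+ nu / nu`!%:R)%:C)%C * convpow N nu x : R[i]^o)
      @[n --> \oo] --> (u x : R[i]^o)} ->
  (J (wt lam b 1 N) <= (1 / 4)%:E)%E ->
  (J (wt lam b 1 N) <= J (wt lam b 0 u) + (1 / 12)%:E)%E.
Proof.
move=> bpi mN mu solN N4.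
have f0 k : 0 <= k.+2`!%:R^-1 :> R by rewrite invr_ge0.
have f1 k : k.+2`!%:R^-1 <= 1 :> R.
  by rewrite invf_le1 ?ltr0n ?fact_gt0// ler1n fact_gt0.
have mA k := cmeasurable_convpow k mN.
have wtA0 k x : (0 <= (k.+2`!%:R^-1)%:E * wt lam b k.+2 (convpow N k.+2) x)%E.
  by rewrite mule_ge0 ?wt_ge0// lee_fin.
have mwtA k : measurable_fun setT
    (fun x => (k.+2`!%:R^-1)%:E * wt lam b k.+2 (convpow N k.+2) x)%E.
  by apply: measurable_funeM; exact: measurable_wt.
have mS : measurable_fun setT (fun x =>
    \sum_(0 <= k <oo) (k.+2`!%:R^-1)%:E * wt lam b k.+2 (convpow N k.+2) x)%E.
  exact: ge0_emeasurable_sum.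
have S0 x : (0 <= \sum_(0 <= k <oo) (k.+2`!%:R^-1)%:E *
    wt lam b k.+2 (convpow N k.+2) x)%E by exact: nneseries_ge0.
apply: (@le_trans _ _ (J (wt lam b 0 u) + \int[lebesgue_measure]_x
    \sum_(0 <= k <oo) (k.+2`!%:R^-1)%:E * wt lam b k.+2 (convpow N k.+2) x)%E).
  rewrite -ge0_integralD//; last 2 first.
  - by move=> x _; exact: wt_ge0.
  - exact: measurable_wt.
  apply: ae_ge0_le_integral => //.
  - by move=> x _; exact: wt_ge0.
  - exact: measurable_wt.
  - by move=> x _; rewrite adde_ge0 ?wt_ge0.
  - by apply: emeasurable_funD => //; exact: measurable_wt.
  - by apply: filterS (wt_series_head lam bpi solN) => x + _.
rewrite leeD2l// integral_nneseries//.
have -> : 1 / 12 = (1 / 4) / 3 :> R by field.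
apply: le_trans (geometric_quarter_le _); last by rewrite divr_ge0.
apply: lee_nneseries => [k _ _|k _]; first exact: integral_ge0.
rewrite ge0_integralZl ?lee_fin//; first last.
- by move=> x _; exact: wt_ge0.
- exact: measurable_wt.
rewrite -exprS; apply: (le_trans _ (integral_wt_convpow k.+1 bpi mN N4)).
by rewrite gee_pMl ?lee_fin// integral_wt_ge0.
Qed.

(** Moves the dependence on [b] from the integrand to the domain, the form in which continuity of an
    integral in its upper limit applies. *)
Lemma integral_wt_trunc {R : realType} (lam b : R) n (f : R -> R[i]) :
  0 <= b <= pi -> cmeasurable_fun Ipi f ->
  (J (wt lam b n f) =
   \int[lebesgue_measure]_(x in `[0%R, b]) (fine (wt lam pi n f x))%:E)%E.
Proof.
move=> /andP[b0 bpi] mf.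
rewrite [RHS]integral_itv_bndoo; last first.
  apply/measurable_EFinP; apply: measurableT_comp; first exact: fine_measurable.
  exact: measurable_funTS (measurable_wt _ _ _ mf).
rewrite [RHS]integral_mkcond; apply: eq_integral => x _.
have [xb|xb] := boolP (0 < x < b).
  rewrite patchE mem_set/= ?in_itv//= wtE// wtE//.
  by case/andP: xb => -> xb; rewrite (lt_le_trans xb).
rewrite patchE memNset/= ?wt_off//.
by rewrite in_itv/=; exact/negP.
Qed.

(* The norm on [0, b] depends continuously on b and vanishes at b = 0, and the
   Picard estimate keeps it from ever taking the value 1/4. *)
Lemma integral_wt_solution {R : realType} (lam : R) (u N : R -> R[i]) :
  cmeasurable_fun Ipi N -> cmeasurable_fun Ipi u ->
  {ae lebesgue_measure, forall x : R, Ipi x ->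
    (\sum_(1 <= nu < n.+1) (((pi - x) ^+ nu / nu`!%:R)%:C)%C * convpow N nu x : R[i]^o)
      @[n --> \oo] --> (u x : R[i]^o)} ->
  (J (wt lam pi 0 u) <= (1 / 8)%:E)%E ->
  (J (wt lam pi 1 N) < +oo)%E ->
  (J (wt lam pi 1 N) <= (1 / 4)%:E)%E.
Proof.
move=> mN mu solN u8 Nfin.
have pi0 : 0 <= pi :> R := pi_ge0 R.
pose F x := fine (wt lam pi 1 N x).
have FE x : (F x)%:E = wt lam pi 1 N x.
  by rewrite /F; have [xb|xb] := boolP (0 < x < pi); [rewrite wtE|rewrite wt_off].
have intF : lebesgue_measure.-integrable `[0, pi] (EFin \o F).
  apply: (@integrableS _ _ _ _ setT) => //.
  have -> : EFin \o F = wt lam pi 1 N by apply/funext => x; rewrite /= FE.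
  apply/integrableP; split; first exact: measurable_wt.
  by under eq_integral do rewrite gee0_abs ?wt_ge0//.
have cF := parameterized_integral_continuous pi0 intF.
have sE b : 0 <= b <= pi ->
    J (wt lam b 1 N) = (parameterized_integral lebesgue_measure 0 b F)%:E.
  move=> /[dup] b0pi /andP[b0 bpi]; rewrite /parameterized_integral /Rintegral.
  rewrite fineK ?integral_wt_trunc//.
  apply: integrable_fin_num => //.
  apply: integrableS intF => //; apply: subset_itvl; rewrite bnd_simp//.
have pipi : 0 <= (pi : R) <= pi by rewrite pi0 lexx.
rewrite sE// lee_fin leNgt; apply/negP => s4.
have [|b] := IVT (v := 1 / 4) pi0 cF.
  rewrite {1}/parameterized_integral set_itv1 Rintegral_set1.
  by rewrite ge_min le_max (ltW s4) divr_ge0//= orbT.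
rewrite in_itv/= => /[dup] b0pi /andP[b0 bpi] sb.
have := integral_wt_picard (lam := lam) bpi mN mu solN.
rewrite (sE _ b0pi) sb => /(_ (lexx _)).
have : (J (wt lam b 0 u) <= (1 / 8)%:E)%E.
  apply: le_trans u8; apply: ge0_le_integral => //.
  - by move=> x _; exact: wt_ge0.
  - exact: measurable_wt.
  - exact: measurable_wt.
  move=> x _; have [xb|/wt_off->] := boolP (0 < x < b); last exact: wt_ge0.
  by rewrite !wtE//; case/andP: xb => -> /lt_le_trans->.
(* The contradiction is 1/8 + 1/12 = 5/24 < 1/4. *)
move=> ub le1; have := le_trans le1 (leeD ub (lexx _)).
by rewrite -EFinD lee_fin; lra.
Qed.

(** * Weighted L1 norms controlled by the L2 norm *)

Lemma normc_sqr {R : rcfType} (z : R[i]) :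
  normc z ^+ 2 = complex.Re z ^+ 2 + complex.Im z ^+ 2.
Proof. by case: z => a b /=; rewrite sqr_sqrtr// addr_ge0 ?sqr_ge0. Qed.

Lemma measurable_normc_sqr {R : realType} (D : set R) (f : R -> R[i]) :
  cmeasurable_fun D f -> measurable_fun D (fun x => normc (f x) ^+ 2).
Proof.
move=> [fr fi]; under eq_fun do rewrite normc_sqr.
by apply: measurable_funD; exact: measurable_funX.
Qed.

Lemma integral_normc_sqr {R : realType} (f : R -> R[i]) :
  (\int[lebesgue_measure]_(x in Ipi) (normc (f x) ^+ 2)%:E =
   cLnorm 2%:E f `^ 2)%E.
Proof.
rewrite integral_mkcond /cLnorm poweR_Lnorm//.
apply: eq_integral => x _; rewrite !patchE; case: ifP => _.
  rewrite abse_EFin poweR_EFin ger0_norm ?normr_ge0//; last first.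
    by case: (f x) => a b /=; rewrite sqrtr_ge0.
  rewrite powR_mulrn//.
  by case: (f x) => a b /=; rewrite sqrtr_ge0.
by rewrite abse0 poweR0r.
Qed.

Lemma expRN_le1 {R : realType} (t : R) : 0 <= t -> expR (- t) <= 1.
Proof. by move=> t0; rewrite -expR0 ler_expR oppr_le0. Qed.

Lemma expRN_le_inv {R : realType} (t : R) : 0 < t -> expR (- t) <= t^-1.
Proof.
move=> t0; rewrite expRN lef_pV2 ?posrE ?expR_gt0//.
by apply: le_trans (expR_ge1Dx t); rewrite lerDr.
Qed.

(* AM-GM: [2 e m <= eta m^2 + e / eta] for [0 <= e <= 1]; then [e = exp (- lam x)]
   is bounded by 1 on ]0, h[ and by [exp (- lam h)] beyond. *)
Lemma integral_wt0_le {R : realType} (lam eta h b : R) (f : R -> R[i]) :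
  0 <= lam -> 0 < eta -> 0 <= h -> b <= pi -> cmeasurable_fun Ipi f ->
  (J (wt lam b 0 f) <=
   eta%:E * \int[lebesgue_measure]_(x in Ipi) (normc (f x) ^+ 2)%:E +
   (eta^-1 * (h + pi * expR (- (lam * h))))%:E)%E.
Proof.
move=> lam0 eta0 h0 bpi mf.
have pi0 : 0 <= pi :> R := pi_ge0 R; have mI := @measurable_Ipi R.
have ie0 : 0 <= eta^-1 by rewrite invr_ge0 ltW.
set kap := expR (- (lam * h)); have kap0 : 0 <= kap := expR_ge0 _.
pose G1 : R -> \bar R := (fun x => (normc (f x) ^+ 2)%:E) \_ Ipi.
pose G2 : R -> \bar R := (cst 1%:E) \_ `]0, h[%classic.
pose G3 : R -> \bar R := (cst 1%:E) \_ Ipi.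
have mG1 : measurable_fun setT G1.
  apply/(measurable_restrictT _ _).1 => //.
  by apply/measurable_EFinP; exact: measurable_normc_sqr.
have mG2 : measurable_fun setT G2.
  by apply/(measurable_restrictT _ _).1 => //; exact: measurable_cst.
have mG3 : measurable_fun setT G3.
  by apply/(measurable_restrictT _ _).1 => //; exact: measurable_cst.
have G10 x : (0 <= G1 x)%E.
  by rewrite /G1 patchE; case: ifP => // _; rewrite lee_fin sqr_ge0.
have G20 x : (0 <= G2 x)%E by rewrite /G2 patchE; case: ifP.
have G30 x : (0 <= G3 x)%E by rewrite /G3 patchE; case: ifP.
have JG2 : J G2 = h%:E.
  rewrite -integral_mkcond integral_cst// mul1e/= lebesgue_measure_itv/= lte_fin.
  case: ltP => [_|h0']; first by rewrite oppr0 adde0.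
  by congr EFin; apply/eqP; rewrite eq_le h0.
have JG3 : J G3 = pi%:E.
  rewrite -integral_mkcond integral_cst//.
  by rewrite mul1e/= /Ipi lebesgue_measure_itv/= lte_fin pi_gt0 oppr0 adde0.
rewrite [X in (_ <= eta%:E * X + _)%E]integral_mkcond -/G1.
have -> : (eta^-1 * (h + pi * kap))%:E =
    (eta^-1%:E * J G2 + (eta^-1 * kap)%:E * J G3)%E.
  by rewrite JG2 JG3 -!EFinM -EFinD; congr EFin; ring.
have c20 x : (0 <= eta^-1%:E * G2 x)%E by rewrite mule_ge0// lee_fin.
have c30 x : (0 <= (eta^-1 * kap)%:E * G3 x)%E by rewrite mule_ge0// lee_fin mulr_ge0.
have c10 x : (0 <= eta%:E * G1 x)%E by rewrite mule_ge0// lee_fin ltW.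
have mc1 : measurable_fun setT (fun x => eta%:E * G1 x)%E by exact: measurable_funeM.
have mc2 : measurable_fun setT (fun x => eta^-1%:E * G2 x)%E by exact: measurable_funeM.
have mc3 : measurable_fun setT (fun x => (eta^-1 * kap)%:E * G3 x)%E.
  exact: measurable_funeM.
rewrite -!ge0_integralZl ?lee_fin ?mulr_ge0 ?(ltW eta0)//.
rewrite -ge0_integralD// -ge0_integralD//; first last.
- exact: emeasurable_funD.
- by move=> x _; rewrite adde_ge0.
apply: ge0_le_integral => //.
- by move=> x _; exact: wt_ge0.
- exact: measurable_wt.
- by apply: emeasurable_funD => //; exact: emeasurable_funD.
move=> x _; have [xb|/wt_off->] := boolP (0 < x < b); last by rewrite !adde_ge0.
have /andP[x0 ltxb] := xb.
rewrite wtE// expr0 mulr1 /G1 /G2 /G3 !patchE.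
have -> : x \in @Ipi R.
  by rewrite inE /Ipi/= in_itv/= x0 (lt_le_trans ltxb).
set e := expR _; have e0 : 0 <= e := expR_ge0 _.
have e1 : e <= 1 by rewrite expRN_le1// mulr_ge0// ltW.
set m := normc (f x).
have eb : (e%:E <= (cst 1%:E \_ `]0%R, h[) x + kap%:E)%E.
  rewrite patchE; case: ifPn => [_|]; first by rewrite -EFinD lee_fin ler_wpDr.
  move=> /negP xh; rewrite add0e lee_fin ler_expR lerN2 ler_wpM2l// leNgt.
  by apply/negP => ltxh; apply: xh; rewrite inE/= in_itv/= x0.
have amgm : 2 * e * m <= eta * m ^+ 2 + eta^-1 * e.
  (* Expanding the square gives the bound with [e * e] in the last term, and [e * e <= e] because
     [e <= 1]. *)
  have : 0 <= eta * (m - e / eta) ^+ 2 by rewrite mulr_ge0 ?sqr_ge0 ?ltW.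
  have -> : eta * (m - e / eta) ^+ 2 = eta * m ^+ 2 - 2 * e * m + eta^-1 * (e * e).
    by field; rewrite gt_eqF.
  have : eta^-1 * (e * e) <= eta^-1 * e by rewrite ler_wpM2l// ler_piMr.
  lra.
(* The factor 2 on the left of [amgm] pays for passing from [nrm1] to the modulus. *)
apply: (@le_trans _ _ ((eta * m ^+ 2)%:E + eta^-1%:E * e%:E)%E).
  rewrite -EFinM -EFinD lee_fin (le_trans _ amgm)//.
  by rewrite [2 * e]mulrC -mulrA ler_wpM2l// nrm1_le_normc.
rewrite EFinM leeD2l// mule1.
apply: (le_trans (lee_wpmul2l _ eb)); first by rewrite lee_fin.
by rewrite ge0_muleDr ?lee_fin.
Qed.

Lemma integral_wt0_small {R : realType} (r : R) : 0 < r ->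
  exists2 lam : R, 0 <= lam & forall u : R -> R[i], cmeasurable_fun Ipi u ->
    (\int[lebesgue_measure]_(x in Ipi) (normc (u x) ^+ 2)%:E <= (r ^+ 2)%:E)%E ->
    (J (wt lam pi 0 u) <= (1 / 8)%:E)%E.
Proof.
(* With these values [eta * r ^+ 2] and [eta^-1 * (h + h)] both equal 1/16, which adds up to 1/8. *)
move=> r0; pose eta := (16 * r ^+ 2)^-1; pose h := (512 * r ^+ 2)^-1.
have r20 : 0 < r ^+ 2 by rewrite exprn_gt0.
have h0 : 0 < h by rewrite invr_gt0; lra.
have eta0 : 0 < eta by rewrite invr_gt0 mulr_gt0.
have pi0 : 0 < pi :> R := pi_gt0 R.
(* This [lam] gives [lam * h = pi / h], and the bound of [expR (- t)] by [t^-1] then makes the tail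
   term [pi * expR (- (lam * h))] at most [h]. *)
exists (pi / h ^+ 2) => [|u mu u2].
  by rewrite divr_ge0 ?exprn_ge0 ?ltW.
have lam0 : 0 <= pi / h ^+ 2 by rewrite divr_ge0 ?exprn_ge0 ?ltW.
apply: (le_trans (integral_wt0_le lam0 eta0 (ltW h0) (lexx _) mu)).
apply: (le_trans (leeD (lee_wpmul2l _ u2) (lexx _))); first by rewrite lee_fin ltW.
rewrite -EFinM -EFinD lee_fin.
have -> : pi / h ^+ 2 * h = pi / h by field; rewrite gt_eqF.
have kap : pi * expR (- (pi / h)) <= h.
  apply: (@le_trans _ _ (pi * (pi / h)^-1)).
    by rewrite (ler_wpM2l (ltW pi0))// expRN_le_inv// divr_gt0.
  by rewrite invf_div mulrCA divff ?mulr1// gt_eqF.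
have : eta^-1 * (h + pi * expR (- (pi / h))) <= eta^-1 * (h + h).
  by apply: ler_wpM2l; [rewrite invr_ge0 ltW|rewrite lerD2l].
have -> : eta^-1 * (h + h) = 1 / 16.
  by rewrite /eta /h; field; rewrite gt_eqF.
have -> : eta * r ^+ 2 = 1 / 16 by rewrite /eta; field; rewrite gt_eqF.
lra.
Qed.

(** * Reflected data and the weight [pi - x] *)

Lemma Ipi_rsub {R : realType} (x : R) : Ipi (pi - x) <-> Ipi x.
Proof.
rewrite /Ipi/= !in_itv/= subr_gt0 ltrBlDr ltrDl.
by split=> /andP[-> ->].
Qed.

Lemma cmeasurable_reflect {R : realType} (w : R -> R[i]) :
  cmeasurable_fun Ipi w -> cmeasurable_fun Ipi (fun x => w (pi - x)).
Proof.
move=> [wr wi].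
have mx : measurable_fun (@Ipi R) (fun x => pi - x) by exact: measurable_fun_rsub.
have sx : [set pi - x | x in @Ipi R] `<=` Ipi by move=> _ [x /Ipi_rsub + <-].
split.
- exact: (measurable_comp measurable_Ipi sx wr mx).
- exact: (measurable_comp measurable_Ipi sx wi mx).
Qed.

Lemma integral_normc_sqr_reflect {R : realType} (w : R -> R[i]) :
  cmeasurable_fun Ipi w ->
  (\int[lebesgue_measure]_(x in Ipi) (normc (w (pi - x)%R) ^+ 2)%:E =
   \int[lebesgue_measure]_(x in Ipi) (normc (w x) ^+ 2)%:E)%E.
Proof.
move=> mw; have mI := @measurable_Ipi R.
pose G : R -> \bar R := (fun x => (normc (w x) ^+ 2)%:E) \_ Ipi.
have mG : measurable_fun setT G.
  apply/(measurable_restrictT _ _).1 => //.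
  by apply/measurable_EFinP; exact: measurable_normc_sqr.
have G0 x : (0 <= G x)%E.
  by rewrite /G patchE; case: ifP => // _; rewrite lee_fin sqr_ge0.
rewrite [LHS]integral_mkcond [RHS]integral_mkcond -/G -(ge0_integral_rsub pi mG G0).
apply: eq_integral => x _; rewrite /G !patchE.
suff -> : (pi - x \in @Ipi R) = (x \in Ipi) by [].
by apply/idP/idP; rewrite !inE => /Ipi_rsub.
Qed.

(** Membership in [in_L2pi] speaks of the weighted function only; division by [pi - x], continuous
    and nonzero on [Ipi], recovers [f]. *)
Lemma cmeasurable_weight_pi {R : realType} (f : R -> R[i]) :
  cmeasurable_fun Ipi (weight_pi f) -> cmeasurable_fun Ipi f.
Proof.
move=> [fr fi]; have mI := @measurable_Ipi R.
have px x : Ipi x -> pi - x != 0 :> R.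
  by rewrite /Ipi/= in_itv/= => /andP[_ xpi]; rewrite gt_eqF// subr_gt0.
have minv : measurable_fun (@Ipi R) (fun x => (pi - x)^-1).
  apply: open_continuous_measurable_fun; first exact: interval_open.
  move=> x /set_mem /px px0; apply: cvgV => //.
  by apply: cvgB; [exact: cvg_cst|exact: cvg_id].
split.
- apply: (eq_measurable_fun _ _ (measurable_funM minv fr)) => x /set_mem /px px0.
  by rewrite /weight_pi /=; case: (f x) => a b /=; rewrite mul0r subr0 mulKf.
- apply: (eq_measurable_fun _ _ (measurable_funM minv fi)) => x /set_mem /px px0.
  by rewrite /weight_pi /=; case: (f x) => a b /=; rewrite mul0r addr0 mulKf.
Qed.

Lemma wt1_weight_pi {R : realType} (lam b : R) (f : R -> R[i]) : b <= pi ->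
  wt lam b 1 f = wt lam b 0 (weight_pi f).
Proof.
move=> bpi; apply/funext => x.
have [xb|xb] := boolP (0 < x < b); last by rewrite !wt_off.
rewrite !wtE// /weight_pi nrm1_scale; last first.
  by rewrite subr_ge0; case/andP: xb => _ /ltW/le_trans; apply.
by rewrite expr0 expr1 mulr1 mulrA.
Qed.

(** Only finiteness matters here, so [integral_wt0_le] is applied with [eta] and [h] both equal to
    1. *)
Lemma integral_wt1_fin {R : realType} (lam : R) (N : R -> R[i]) :
  0 <= lam -> in_L2pi N -> (J (wt lam pi 1 N) < +oo)%E.
Proof.
move=> lam0 [mN Nfin]; rewrite wt1_weight_pi//.
apply: (le_lt_trans (integral_wt0_le lam0 ltr01 ler01 (lexx _) mN)).
rewrite mul1e integral_normc_sqr lte_add_pinfty ?ltry//.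
have N0 : (0 <= cLnorm 2%:E (weight_pi N))%E := Lnorm_ge0 _ _ _.
rewrite -(@fineK _ (cLnorm 2%:E (weight_pi N))) ?ge0_fin_numE//.
by rewrite poweR_EFin ltry.
Qed.

(** The smallness property is a hypothesis so that one [lam], depending on [r] alone, can serve both
    solutions. *)
Lemma integral_wt1_solution {R : realType} (r lam : R) (w N : R -> R[i]) :
  0 < r -> 0 <= lam ->
  (forall u : R -> R[i], cmeasurable_fun Ipi u ->
    (\int[lebesgue_measure]_(x in Ipi) (normc (u x) ^+ 2)%:E <= (r ^+ 2)%:E)%E ->
    (J (wt lam pi 0 u) <= (1 / 8)%:E)%E) ->
  in_L2 w -> (cLnorm 2%:E w <= r%:E)%E -> in_L2pi N -> is_solution w N ->
  (J (wt lam pi 1 N) <= (1 / 4)%:E)%E.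
Proof.
move=> r0 lam0 small [mw _] wr N2 solN.
have mN : cmeasurable_fun Ipi N by apply: cmeasurable_weight_pi; case: N2.
have mu := cmeasurable_reflect mw.
apply: (integral_wt_solution mN mu solN); last exact: integral_wt1_fin.
apply: small => //; rewrite integral_normc_sqr_reflect// integral_normc_sqr.
have w0 : (0 <= cLnorm 2%:E w)%E := Lnorm_ge0 _ _ _.
rewrite -(powR_mulrn _ (ltW r0)) -poweR_EFin gt0_ler_poweR// in_itv/= leey ?w0//.
by rewrite lee_fin ltW.
Qed.

(** * The essential supremum norm and the final estimate *)

Lemma cLnormyE {R : realType} (f : R -> R[i]) :
  cLnorm +oo%E f = ess_sup lebesgue_measure
    (abse \o ((fun x => (normc (f x))%:E) \_ Ipi)).
Proof.
(* At exponent [+oo] the norm is the essential supremum only if the whole space has positive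
   measure, which is checked for the line. *)
rewrite /cLnorm unlock/= ifT//.
by rewrite -set_itvNyy lebesgue_measure_itv/= addye// lt0y.
Qed.

Lemma normc_ge0 {R : rcfType} (z : R[i]) : 0 <= normc z.
Proof. by case: z => a b; rewrite sqrtr_ge0. Qed.

Lemma cLnormy_leP {R : realType} (f : R -> R[i]) (e : R) : 0 <= e ->
  (cLnorm +oo%E f <= e%:E)%E <->
  {ae lebesgue_measure, forall x, Ipi x -> normc (f x) <= e}.
Proof.
move=> e0; rewrite cLnormyE; split=> [/ess_supP|fe].
  apply: filterS => x + Ix; rewrite /= patchE mem_set// abse_EFin lee_fin.
  by rewrite ger0_norm// normc_ge0.
apply/ess_supP; apply: filterS fe => x fe; rewrite /= patchE.
case: ifPn => [/set_mem/fe|_]; last by rewrite abse0 lee_fin.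
by rewrite abse_EFin lee_fin ger0_norm// normc_ge0.
Qed.

Theorem lemma3 (R : realType) (r : R) (hr : 0 < r) :
  exists2 Cr : R, 0 < Cr &
    forall w w' N N' : R -> R[i],
      in_L2 w -> in_L2 w' ->
      (cLnorm 2%:E w <= r%:E)%E -> (cLnorm 2%:E w' <= r%:E)%E ->
      in_L2pi N -> in_L2pi N' ->
      is_solution w N -> is_solution w' N' ->
      (norm_inftypi (fun x => (N x - N' x)%R) <=
         Cr%:E * cLnorm +oo (fun x => (w x - w' x)%R))%E.
Proof.
have [lam lam0 small] := integral_wt0_small hr.
(* One factor 2 comes from comparing [nrm1] with the modulus of the data, the other from [2 * eps]
   in [stability_small]; the exponential undoes the weight on [Ipi]. *)
exists (4 * expR (lam * pi)) => [|w w' N N' w2 w'2 wr w'r N2 N'2 solN solN'].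
  by rewrite mulr_gt0// expR_gt0.
have mN : cmeasurable_fun Ipi N by apply: cmeasurable_weight_pi; case: N2.
have mN' : cmeasurable_fun Ipi N' by apply: cmeasurable_weight_pi; case: N'2.
have N4 := integral_wt1_solution hr lam0 small w2 wr N2 solN.
have N'4 := integral_wt1_solution hr lam0 small w'2 w'r N'2 solN'.
have C0 : 0 < 4 * expR (lam * pi) by rewrite mulr_gt0// expR_gt0.
have : (0 <= cLnorm +oo (fun x => (w x - w' x)%R))%E := Lnorm_ge0 _ _ _.
case ww'E : (cLnorm +oo _) => [e| |]; last by [].
- rewrite lee_fin => e0; rewrite -EFinM.
  have ww' : {ae lebesgue_measure, forall x : R, Ipi x ->
      nrm1 (w (pi - x) - w' (pi - x)) <= 2 * e}.
    (* The equations involve the data at [pi - x], so the almost everywhere bound is reflected. *)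
    have /(cLnormy_leP _ e0)/(ae_rsub pi) :
        (cLnorm +oo (fun x => (w x - w' x)%R) <= e%:E)%E by rewrite ww'E.
    apply: filterS => x le_e /Ipi_rsub/le_e {}le_e.
    by rewrite (le_trans (nrm1_le_normc _))// ler_wpM2l.
  have e20 : 0 <= 2 * e by rewrite mulr_ge0.
  have := stability_small lam0 e20 mN mN' solN solN' N4 N'4 ww'.
  move=> D; apply/cLnormy_leP; first by rewrite mulr_ge0// ltW.
  apply: filterS D => x + Ix; have : 0 < x < pi by move: Ix; rewrite /Ipi/= in_itv.
  move=> /[dup] xpi /andP[x0 ltxpi]; rewrite wtE// lee_fin expr1 => D.
  rewrite (le_trans (normc_le_nrm1 _))// /weight_pi nrm1_scale ?subr_ge0 ?(ltW ltxpi)//.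
  set v := _ * nrm1 _ in D *.
  have v0 : 0 <= v by rewrite mulr_ge0 ?nrm1_ge0// subr_ge0 ltW.
  have {}D : v <= expR (lam * x) * (2 * (2 * e)).
    rewrite -ler_pdivrMl ?expR_gt0// -expRN; move: D; rewrite /v; lra.
  rewrite (le_trans D)// mulrAC.
  rewrite (_ : 4 * e * _ = expR (lam * pi) * (2 * (2 * e))); last by ring.
  by rewrite ler_wpM2r ?mulr_ge0// ler_expR ler_wpM2l// ltW.
(* An infinite right-hand side stays infinite after multiplication by the positive constant. *)
- by move=> _; rewrite gt0_muley ?lte_fin// leey.
Qed.
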